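(* Let $S_{\alpha_1},\dots,S_{\alpha_s}\subset G(l,m)$ be finitely many Schubert cycles with respect to the fixed flag $A_1\subset\dots\subset A_m=V$. Let $S_\gamma=\bigcap_{i=1}^s S_{\alpha_i}$ be their intersection and $S_U=\bigcup_{i=1}^s S_{\alpha_i}$ their union, and put $G_U=\bigcup_{i=1}^s G_{\alpha_i}$. Then: (1) the intersection $S_\gamma$ is itself a Schubert cycle, with grid $G_\gamma=\bigcap_{i=1}^s G_{\alpha_i}$; (2) $\mathcal L(S_U)\cap G(l,m)=S_U$; (3) $\dim L(S_U)$ equals the cardinality of the grid $G_U$; (4) if $F=F_q$ is a finite field, the number of $F_q$-rational points on $S_U$ is $\sum_{(x_1,\dots,x_l)\in G_U} q^{x_1+\dots+x_l-l(l+1)/2}$.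
   Context: Let $F$ be a field, $1\le l<m$ integers, $V$ an $m$-dimensional $F$-vector space with basis $e_1,\dots,e_m$, and $A_i=\mathrm{Span}(e_1,\dots,e_i)$. $G(l,m)$ is the Grassmann variety of $l$-dimensional subspaces of $V$, embedded by Plücker coordinates in $\mathbf P(\wedge^l V)=\mathbf P^{k-1}$, $k=\binom{m}{l}$. Let $G_{G(l,m)}=\{(b_1,\dots,b_l)\in\mathbf Z^l : 1\le b_1<\dots<b_l\le m\}$, partially ordered by $\alpha\le\beta$ iff $a_i\le b_i$ for all $i$. For $\alpha=(a_1,\dots,a_l)\in G_{G(l,m)}$ the Schubert cycle is $S_\alpha=\{W\in G(l,m): \dim(W\cap A_{a_i})\ge i,\ i=1,\dots,l\}$, and its grid is $G_\alpha=\{\beta\in G_{G(l,m)}:\beta\le\alpha\}$. For a subset $M\subset G(l,m)$, $\mathcal L(M)$ is its linear span in the projective space $\mathbf P(\wedge^l V)$, and $L(M)\subset\wedge^l V$ is the linear span of the affine cone over $M$. *)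

(* Defs.v *)
From mathcomp Require Import all_boot all_order all_algebra.
From mathcomp Require Import boolp classical_sets functions cardinality.

Set Implicit Arguments.
Unset Strict Implicit.
Unset Printing Implicit Defensive.

Import GRing.Theory.
Local Open Scope ring_scope.
Local Open Scope classical_set_scope.

(* Strictly increasing l-tuples (b_1, ..., b_l) of integers in [1, m].  The   *)
(* components are stored in 'I_m, so that they directly index the basis of V; *)
(* [entry b i] is the integer b_(i+1) in [1, m] (i : 'I_l is 0-based).        *)
Definition grid (l m : nat) :=
  {b : l.-tuple 'I_m | sorted ltn (map val b)}.

Definition entry (l m : nat) (b : grid l m) (i : 'I_l) : nat :=
  (tnth (val b) i).+1.

Definition grid_le (l m : nat) (a b : grid l m) : bool :=
  [forall i : 'I_l, (entry a i <= entry b i)%N].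

Definition below (l m : nat) (a : grid l m) : {set grid l m} :=
  [set b | grid_le b a]%SET.

Lemma card_grid (l m : nat) : #|{: grid l m}| = 'C(m, l).
Proof.
rewrite card_sig -card_ltn_sorted_tuples cardsE.
by apply: eq_card => t; rewrite !inE.
Qed.

Section LinearSpan.
Variables (F : fieldType) (E : vectType F).

(* Smallest subspace containing a possibly infinite subset of E.              *)
Definition is_span (A : set E) (U : {vspace E}) : Prop :=
  (forall v, A v -> v \in U) /\
  (forall U' : {vspace E}, (forall v, A v -> v \in U') -> (U <= U')%VS).

Lemma is_span_ex (A : set E) : exists U, is_span A U.
Proof.
pose P (s : seq E) := forall v, v \in s -> A v.
suff [s Ps maxs] : exists2 s, P s &
    forall v, A v -> v \in <<s>>%VS.
  exists <<s>>%VS; split=> // U' AU'; apply/span_subvP => v /Ps; exact: AU'.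
have IH n : forall s, P s -> (\dim {:E} - \dim <<s>>%VS <= n)%N ->
    exists2 s', P s' & forall v, A v -> v \in <<s'>>%VS.
  elim: n => [|n IHn] s Ps.
    rewrite leqn0 subn_eq0 => le_s; exists s => // v _.
    suff -> : <<s>>%VS = fullv by exact: memvf.
    by apply/eqP; rewrite eqEdim subvf.
  move=> les.
  have [Asub|/existsNP[v /not_implyP[Av /negP nv]]] :=
      pselect (forall v, A v -> v \in <<s>>%VS); first by exists s.
  apply: (IHn (v :: s)).
    by move=> w; rewrite inE => /orP[/eqP->//|/Ps].
  have lt_s : (\dim <<s>>%VS < \dim <<v :: s>>%VS)%N.
    have sub : (<<s>> <= <<v :: s>>)%VS.
      by apply: sub_span => w ws; rewrite inE ws orbT.
    rewrite ltnNge; apply/negP => le_d; case/negP: nv.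
    have /eqP -> : <<s>>%VS == <<v :: s>>%VS by rewrite eqEdim sub.
    by apply: memv_span; rewrite mem_head.
  rewrite leq_subLR in les; rewrite leq_subLR.
  by apply: leq_trans les _; rewrite addnS -addSn leq_add2r.
by apply: (IH (\dim {:E}) [::]) => //; apply: leq_subr.
Qed.

Definition lspan (A : set E) : {vspace E} := sval (cid (is_span_ex A)).

Lemma lspanP (A : set E) : is_span A (lspan A).
Proof. exact: svalP (cid (is_span_ex A)). Qed.

End LinearSpan.

(* The l-th exterior power of a space with basis e_1, ..., e_m, through its   *)
(* coordinates on the basis e_b = e_(b_1) /\ ... /\ e_(b_l), b in grid l m.   *)
Definition extpow (F : fieldType) (l m : nat) := {ffun grid l m -> F^o}.

Lemma dim_extpow (F : fieldType) (l m : nat) :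
  \dim {: extpow F l m} = 'C(m, l).
Proof. by rewrite dimvf /dim /= muln1 card_grid. Qed.

Section Grassmannian.
Variables (F : fieldType) (l m : nat) (V : vectType F) (e : m.-tuple V).

(* w_1 /\ ... /\ w_l: its coordinate on e_b is the minor, with columns b, of  *)
(* the matrix whose rows are the coordinates of the w_i in the basis e.       *)
Definition wedge (w : 'I_l -> V) : extpow F l m :=
  [ffun b => \det (\matrix_(i < l, j < l) coord e (tnth (val b) j) (w i))].

Definition grassmannian : set {vspace V} := [set W | \dim W = l].

(* Points of P(extpow F l m) are the one-dimensional subspaces.  For W in the *)
(* Grassmannian, the line below does not depend on the basis chosen for W.    *)
Definition plucker (W : {vspace V}) : {vspace extpow F l m} :=
  <[wedge (fun i => (vbasis W)`_i)]>%VS.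

Definition affine_cone (M : set {vspace V}) : set (extpow F l m) :=
  [set v | exists2 W, M W & v \in plucker W].

Definition linear_span (M : set {vspace V}) : {vspace extpow F l m} :=
  lspan (affine_cone M).

Definition proj_span (M : set {vspace V}) : set {vspace extpow F l m} :=
  [set p | \dim p = 1%N /\ (p <= linear_span M)%VS].

Definition flag (i : nat) : {vspace V} := <<take i e>>%VS.

Definition schubert (a : grid l m) : set {vspace V} :=
  [set W | grassmannian W /\
           forall i : 'I_l, (i.+1 <= \dim (W :&: flag (entry a i))%VS)%N].

End Grassmannian.

Arguments grassmannian {F} l V _.
Arguments plucker {F} l {m V} e W.
Arguments affine_cone {F} l {m V} e M _.
Arguments linear_span {F} l {m V} e M.
Arguments proj_span {F} l {m V} e M _.

(* Main.v *)
Require Import Defs.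
From mathcomp Require Import all_boot all_order all_algebra.
From mathcomp Require Import boolp classical_sets functions cardinality.

Set Implicit Arguments.
Unset Strict Implicit.
Unset Printing Implicit Defensive.

Import GRing.Theory.

Local Open Scope ring_scope.
Local Open Scope classical_set_scope.
Local Open Scope card_scope.

(** The proof rests on Gaussian elimination along the flag.  Call [j] a pivot of
    a subspace [W] if some vector of [W] has its last nonzero coordinate at [j].
    The dimension of the intersection of [W] with the flag jumps exactly at the
    pivots ([dim_cap_flag]); hence an [l]-dimensional [W] has [l] pivots, they
    form an element [b] of the grid, and [W] lies in the Schubert cycle of [a]
    if and only if [b <= a] ([schubert_pivots]).  So a union of Schubert cycles
    is the disjoint union, over a down-closed set [G] of the grid, of the cells
    of subspaces with pivots [b] in [G] ([schubert_bigcup_cells]).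

    Intersections.  The condition at index [i] imposed by several cycles is the
    one imposed by the smallest of their [i]-th entries, and these minima form
    an increasing sequence ([grid_meet_ex]).

    Linear spans.  The Pluecker coordinate of [W] at [c] is nonzero if and only
    if [W] has a frame at [c], that is, a family of vectors dual to the
    coordinates in [c] ([wedge_vbasis_frame]).  There is a frame at the pivots
    [b] ([pivots_frame]), and a frame at [c] forces [c <= a] whenever [W] lies
    in the cycle of [a] ([schubert_frame]).  So on the cells of a down-closed
    [G] all the Pluecker coordinates off [G] vanish, while the coordinate
    subspace spanned by the [e_(c_i)], with [c] in [G], is the point whose only
    nonzero coordinate is at [c].  Hence the linear span is the coordinate space
    of [G] ([linear_span_cells]), of dimension [#|G|], and a [W] in it has its
    pivots in [G] ([proj_span_cells]).

    Counting.  The frame at the pivots is the reduced row echelon form, which is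
    unique; its free entries sit at the non-pivot positions to the left of each
    pivot, and there are [\sum_i (b_i - i)] of them ([card_free_pos]).  So the
    cell of [b] has [q] to that power points ([card_cells]). *)

(** * Increasing tuples *)

Section GridCombinatorics.
Variables l m : nat.
Implicit Types (b c : grid l m) (i j : 'I_l).

Definition idx b i : 'I_m := tnth (val b) i.

Lemma nth_idx b i : nth 0%N (map val (val b)) i = idx b i :> nat.
Proof.
rewrite (nth_map (idx b i)) ?size_tuple //.
by rewrite [idx b i in RHS](tnth_nth (idx b i)).
Qed.

Lemma idx_ltn b i j : (idx b i < idx b j)%N = (i < j)%N.
Proof.
have homo (x y : 'I_l) : (x < y)%N -> (idx b x < idx b y)%N.
  move=> ltxy; rewrite -!nth_idx.
  apply: (sorted_ltn_nth ltn_trans 0%N (svalP b)) => //;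
    by rewrite inE size_map size_tuple.
case: (ltngtP i j) => [/homo // | /homo ltji | /val_inj ->]; last exact: ltnn.
by apply/negbTE; rewrite -leqNgt ltnW.
Qed.

Lemma idx_inj b : injective (idx b).
Proof.
move=> i j eqij; apply: val_inj; case: (ltngtP i j) => //;
  by rewrite -(idx_ltn b) eqij ltnn.
Qed.

Lemma idx_le b c : grid_le b c = [forall i, (idx b i <= idx c i)%N].
Proof. by []. Qed.

Lemma mem_gridP b (j : 'I_m) : reflect (exists i, j = idx b i) (j \in val b).
Proof. exact: tnthP. Qed.

Lemma idx_mem b i : idx b i \in val b.
Proof. exact: mem_tnth. Qed.

Lemma uniq_grid b : uniq (val b).
Proof.
by apply/(map_uniq (f := val))/(sorted_uniq ltn_trans ltnn); exact: svalP b.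
Qed.

(** Both tuples have [l] distinct entries and are sorted. *)
Lemma eq_grid b c : {subset val b <= val c} -> b = c.
Proof.
move=> sub_bc; apply: val_inj; apply: val_inj => /=; apply: (inj_map val_inj).
apply: (irr_sorted_eq ltn_trans ltnn (svalP b) (svalP c)); apply: eq_mem_map.
by have [] := uniq_min_size (uniq_grid b) sub_bc; rewrite !size_tuple.
Qed.

Lemma card_ord_ltn (n k : nat) :
  (k <= n)%N -> #|[set j : 'I_n | (j < k)%N]%SET| = k.
Proof.
move=> le_kn; rewrite -sum1dep_card.
rewrite (big_ord_narrow le_kn) /=.
by rewrite big_const_ord iter_addn_0 mul1n.
Qed.

(** The entries below [k] occupy an initial segment of the indices.  This turns
    a lower bound on the number of pivots below [k], hence on the dimension of
    an intersection with the flag, into an inequality between entries. *)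
Lemma card_idx_ltn b (k : nat) i :
  (i < #|[set j | (idx b j < k)%N]%SET|)%N = (idx b i < k)%N.
Proof.
have [bk | kb] := ltnP (idx b i) k.
  rewrite -(card_ord_ltn (ltn_ord i)); apply: subset_leq_card.
  apply/fintype.subsetP => j; rewrite !inE ltnS leq_eqVlt => /orP[/eqP/val_inj -> //|].
  by rewrite -(idx_ltn b) => /ltn_trans; apply.
apply/negbTE; rewrite -leqNgt -[leqRHS](card_ord_ltn (ltnW (ltn_ord i))).
apply: subset_leq_card; apply/fintype.subsetP => j; rewrite !inE -(idx_ltn b).
by move=> /leq_trans; apply.
Qed.

Lemma grid_of_set (J : {set 'I_m}) : #|J| = l -> exists b, val b =i J.
Proof.
move=> cardJ.
have szJ : size (enum J) == l by rewrite -cardE cardJ.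
have sortJ : sorted ltn (map val (Tuple szJ)).
  rewrite /= /enum_mem.
  apply: (subseq_sorted ltn_trans _ (iota_ltn_sorted 0 m)).
  by rewrite -val_enum_ord; apply: map_subseq; rewrite enumT; exact: filter_subseq.
by exists (exist _ (Tuple szJ) sortJ) => j; rewrite /= mem_enum.
Qed.

End GridCombinatorics.

(** * Pivots of a subspace along the flag *)

Section Coordinates.
Variables (F : fieldType) (m : nat) (V : vectType F) (e : m.-tuple V).
Hypothesis e_basis : basis_of fullv e.
Implicit Types (v : V) (W : {vspace V}) (j : 'I_m).

Lemma sum_coord v : v = \sum_j coord e j v *: e`_j.
Proof. exact: coord_basis e_basis (memvf v). Qed.

Lemma coordE i j : coord e i e`_j = (j == i)%:R.
Proof. exact: coord_free (basis_free e_basis). Qed.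

Lemma coord_inj v w : (forall j, coord e j v = coord e j w) -> v = w.
Proof.
by move=> eq_vw; rewrite (sum_coord v) (sum_coord w); under eq_bigr do rewrite eq_vw.
Qed.

Lemma mem_flag (k : nat) v :
  reflect (forall j, (k <= j)%N -> coord e j v = 0) (v \in flag e k).
Proof.
apply: (iffP idP) => [vk j le_kj | v0].
  suff /subvP/(_ v vk) : (flag e k <= lker (linfun (coord e j : V -> F^o)))%VS.
    by rewrite memv_ker lfunE => /eqP.
  apply/span_subvP => u /(nthP 0) [i]; rewrite size_take_min leq_min size_tuple.
  case/andP=> lt_ik lt_im; rewrite nth_take // => <-.
  rewrite memv_ker lfunE /= (coordE j (Ordinal lt_im)) -val_eqE /=.
  by rewrite ltn_eqF // (leq_trans lt_ik).
rewrite (sum_coord v); apply: memv_suml => j _; have [lt_jk | le_kj] := ltnP j k.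
  apply/memvZ/memv_span; rewrite -(nth_take 0 lt_jk); apply: mem_nth.
  by rewrite size_take_min leq_min size_tuple lt_jk ltn_ord.
by rewrite v0 // scale0r mem0v.
Qed.

Definition leading v j : Prop :=
  coord e j v != 0 /\ forall i : 'I_m, (j < i)%N -> coord e i v = 0.

Lemma leading_ex v : v != 0 -> exists j, leading v j.
Proof.
move=> v_neq0.
have [j0 vj0] : exists j, coord e j v != 0.
  apply: contrapT => /forallNP v0; case/eqP: v_neq0; apply: coord_inj => j.
  by rewrite linear0; apply/eqP; move/negP: (v0 j); rewrite negbK.
have [j vj maxj] := arg_maxnP (P := fun j => coord e j v != 0) val vj0.
exists j; split=> // i lt_ji; apply/eqP; apply: contraTT lt_ji => /maxj.
by rewrite -leqNgt.
Qed.

(** The leading position is the last nonzero coordinate, because the flag is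
    built from the first basis vectors. *)
Definition is_pivot W j : Prop := exists2 v, v \in W & leading v j.

(** Passing from [flag e k] to [flag e k.+1] adds at most one dimension to the
    intersection with [W], and it adds one exactly when [k] is a pivot. *)
Lemma dim_cap_flag W (k : nat) : (k <= m)%N ->
  \dim (W :&: flag e k) = #|[set j : 'I_m | `[< is_pivot W j >] && (j < k)%N]%SET|.
Proof.
elim: k => [_ | k IHk lt_km].
  have -> : flag e 0 = 0%VS by rewrite /flag take0 span_nil.
  rewrite capv0 dimv0; apply/esym/eqP; rewrite cards_eq0.
  by apply/eqP/setP => j; rewrite !inE ltn0 andbF.
have sub_flag : (W :&: flag e k <= W :&: flag e k.+1)%VS.
  apply/subvP => v /memv_capP[vW /mem_flag vk]; apply/memv_capP; split=> //.
  by apply/mem_flag => j /ltnW; exact: vk.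
(* If [k] is not a pivot the intersection does not grow; otherwise a vector
   leading at [k] spans a complement of the smaller intersection. *)
pose kk := Ordinal lt_km.
have [pk | npk] := pselect (is_pivot W kk); last first.
  have -> : (W :&: flag e k.+1 = W :&: flag e k)%VS.
    apply/eqP; rewrite eqEsubv sub_flag andbT.
    apply/subvP => v /memv_capP[vW /mem_flag vk]; apply/memv_capP; split=> //.
    apply/mem_flag => j; rewrite leq_eqVlt => /orP[/eqP kj|]; last exact: vk.
    apply/eqP/negPn/negP => vj; case: npk; exists v => //.
    have -> : kk = j by apply: val_inj.
    by split=> // i; rewrite -kj; exact: vk.
  rewrite IHk 1?ltnW //; apply: eq_card => j; rewrite !inE ltnS [in RHS]leq_eqVlt.
  have [jk | //] := eqVneq (val j) k.
  have -> : j = kk by apply: val_inj.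
  by rewrite (asboolF npk).
case: (pk) => v vW [vk v0].
have -> : (W :&: flag e k.+1 = W :&: flag e k + <[v]>)%VS.
  apply/eqP; rewrite eqEsubv subv_add sub_flag -memvE /=; apply/andP; split.
    apply/subvP => u /memv_capP[uW /mem_flag uk].
    pose a := coord e kk u / coord e kk v.
    rewrite -(subrK (a *: v) u); apply: memv_add; last exact: memvZ (memv_line _).
    apply/memv_capP; split; first by rewrite memvB ?memvZ.
    apply/mem_flag => j; rewrite linearB linearZ /= leq_eqVlt => /orP[/eqP kj|lt_kj].
      have <- : kk = j by apply: val_inj.
      by rewrite divfK // subrr.
    by rewrite uk // v0 // mulr0 subr0.
  by apply/memv_capP; split=> //; apply/mem_flag => j; exact: v0.
rewrite dimv_disjoint_sum; last first.
  apply/eqP; rewrite -subv0; apply/subvP => u /memv_capP[/memv_capP[_ /mem_flag uk]].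
  case/vlineP => a au; move: (uk kk (leqnn k)) => /eqP.
  rewrite au linearZ /= mulf_eq0 (negbTE vk) orbF => /eqP ->.
  by rewrite scale0r mem0v.
rewrite IHk 1?ltnW // dim_vline.
have -> : v != 0 by apply: contra_neq vk => ->; rewrite linear0.
rewrite [in RHS](cardsD1 kk) !inE ltnS leqnn (asboolT pk) addnC.
congr (_ + _)%N; apply: eq_card => j; rewrite !inE ltnS -val_eqE /= [in RHS]leq_eqVlt.
by case: ltngtP; rewrite ?andbF ?andbT.
Qed.

Lemma card_pivots W : #|[set j : 'I_m | `[< is_pivot W j >]]%SET| = \dim W.
Proof.
have capW : (W :&: flag e m)%VS = W.
  by apply/capv_idPl/subvP => v _; apply/mem_flag => j; rewrite leqNgt ltn_ord.
rewrite -[in RHS]capW dim_cap_flag //; apply: eq_card => j.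
by rewrite !inE ltn_ord andbT.
Qed.

End Coordinates.

(** * Frames and Pluecker coordinates *)

Section Frames.
Variables (F : fieldType) (l m : nat) (V : vectType F) (e : m.-tuple V).
Hypothesis e_basis : basis_of fullv e.
Implicit Types (v : V) (W : {vspace V}) (a b c : grid l m).

Definition pivots W b : Prop := forall j, is_pivot e W j <-> j \in val b.

Lemma pivots_ex W : \dim W = l -> exists b, pivots W b.
Proof.
rewrite -(card_pivots e_basis W) => /grid_of_set[b bE]; exists b => j.
by rewrite bE inE asboolE.
Qed.

Lemma pivots_inj W b c : pivots W b -> pivots W c -> b = c.
Proof. by move=> Wb Wc; apply: eq_grid => j /Wb/Wc. Qed.

Lemma schubert_pivots W a b : \dim W = l -> pivots W b ->
  schubert e a W <-> grid_le b a.
Proof.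
move=> dimW Wb.
have dim_cap i : \dim (W :&: flag e (entry a i))
    = #|[set j | (idx b j < entry a i)%N]%SET|.
  rewrite (dim_cap_flag e_basis) ?ltn_ord //.
  rewrite -(card_imset _ (@idx_inj _ _ b)); apply: eq_card => j.
  rewrite inE; apply/andP/imsetP => [[/asboolP/Wb/mem_gridP[k ->] lt_k] | [k]].
    by exists k; rewrite ?inE.
  by rewrite inE => lt_k ->; split=> //; apply/asboolP/Wb/idx_mem.
rewrite idx_le; split=> [[_ Wa] | /forallP ba].
  by apply/forallP => i; have := Wa i; rewrite dim_cap card_idx_ltn.
by split=> // i; rewrite dim_cap card_idx_ltn; exact: ba.
Qed.

(** The matrix of the [w i], restricted to the columns [b], is the identity; when
    [W] has dimension [l], these vectors form a basis of [W]. *)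
Definition frame W b (w : 'I_l -> V) : Prop :=
  (forall i, w i \in W) /\
  (forall i k, coord e (idx b k) (w i) = (i == k)%:R).

Lemma coord_sum_frame W b w (u : 'I_l -> F) k :
  frame W b w -> coord e (idx b k) (\sum_i u i *: w i) = u k.
Proof.
move=> [_ wb]; rewrite linear_sum /= (bigD1 k) //= big1 => [|i neq_ik].
  by rewrite linearZ /= wb eqxx mulr1 addr0.
by rewrite linearZ /= wb (negbTE neq_ik) mulr0.
Qed.

Lemma frame_free W b w : frame W b w -> free (mktuple w).
Proof.
move=> fw; apply/freeP => u sum0 i.
have sumw0 : \sum_k u k *: w k = 0.
  by rewrite -[RHS]sum0; apply: eq_bigr => k _; rewrite -tnth_nth tnth_mktuple.
by rewrite -(coord_sum_frame u i fw) sumw0 linear0.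
Qed.

Lemma frame_basis W b w : \dim W = l -> frame W b w -> basis_of W (mktuple w).
Proof.
move=> dimW fw; rewrite basisEfree (frame_free fw) size_tuple dimW leqnn andbT.
by apply/span_subvP => _ /mapP[i _ ->]; have [] := fw.
Qed.

Lemma frame_expand W b w v : \dim W = l -> frame W b w -> v \in W ->
  v = \sum_i coord e (idx b i) v *: w i.
Proof.
move=> dimW fw vW.
have [u ->] : exists u : 'I_l -> F, v = \sum_i u i *: w i.
  exists (fun i => coord (mktuple w) i v).
  rewrite {1}(coord_basis (frame_basis dimW fw) vW).
  by apply: eq_bigr => j _; rewrite -tnth_nth tnth_mktuple.
by apply: eq_bigr => i _; rewrite (coord_sum_frame u i fw).
Qed.

(** Both frames have the same coordinates in [b], and these coordinates determine
    a vector of [W]. *)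
Lemma frame_uniq W b w w' : \dim W = l -> frame W b w -> frame W b w' -> w =1 w'.
Proof.
move=> dimW fw [wW' wb'] i; rewrite (frame_expand dimW fw (wW' i)).
rewrite (bigD1 i) //= wb' eqxx scale1r big1 ?addr0 // => k neq_ki.
by rewrite wb' eq_sym (negbTE neq_ki) scale0r.
Qed.

Lemma vbasis_expand (n : nat) W v : \dim W = n -> v \in W ->
  exists u : 'I_n -> F, v = \sum_i u i *: (vbasis W)`_i.
Proof. by move=> <- vW; exists (coord (vbasis W) ^~ v); exact: coord_vbasis. Qed.

Lemma vbasis_indep (n : nat) W (u : 'I_n -> F) : \dim W = n ->
  \sum_i u i *: (vbasis W)`_i = 0 -> forall i, u i = 0.
Proof. by move=> dimW; case: _ / dimW u; exact/freeP/basis_free/vbasisP. Qed.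

(** The minor at [b] of the matrix of a basis of [W] is invertible exactly when
    some change of basis turns the columns [b] into the identity matrix. *)
Lemma wedge_vbasis_frame W b : \dim W = l ->
  wedge e (fun i => (vbasis W)`_i) b != 0 <-> exists w, frame W b w.
Proof.
move=> dimW; rewrite /wedge ffunE -unitfE -/(_ \in unitmx); set M := \matrix_(_, _) _.
have vb (i : 'I_l) : (vbasis W)`_i \in W.
  by apply/vbasis_mem/mem_nth; rewrite size_tuple dimW.
split=> [M_unit | [w fw]].
  exists (fun i => \sum_k invmx M i k *: (vbasis W)`_k); split=> [i | i k].
    by apply: memv_suml => k _; apply: memvZ.
  transitivity ((invmx M *m M) i k); last by rewrite mulVmx // mxE.
  rewrite linear_sum mxE; apply: eq_bigr => j _.
  by rewrite linearZ mxE.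
have /choice[u wE] i : exists u : 'I_l -> F, w i = \sum_k u k *: (vbasis W)`_k.
  by apply: vbasis_expand => //; have [] := fw.
have /mulmx1_unit[] // : (\matrix_(i, k) u i k) *m M = 1%:M.
apply/matrixP => i k; rewrite !mxE; have [_ <-] := fw.
rewrite wE linear_sum; apply: eq_bigr => j _.
by rewrite linearZ !mxE.
Qed.

(** Injectivity of the projection to the coordinates of [b] makes the matrix of
    a basis of [W] in these coordinates invertible. *)
Lemma frame_ex W b : \dim W = l ->
    (forall v, v \in W -> (forall i, coord e (idx b i) v = 0) -> v = 0) ->
  exists w, frame W b w.
Proof.
move=> dimW inj_b; apply/wedge_vbasis_frame => //; rewrite ffunE.
apply/det0P => -[u u_neq0 uM0]; case/eqP: u_neq0.
have sum0 : \sum_i u 0 i *: (vbasis W)`_i = 0.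
  apply: inj_b => [|k].
    apply: memv_suml => i _; apply/memvZ/vbasis_mem/mem_nth.
    by rewrite size_tuple dimW.
  move/matrixP/(_ 0 k): uM0; rewrite !mxE => <-; rewrite linear_sum.
  by apply: eq_bigr => i _; rewrite linearZ !mxE.
apply/rowP => i; rewrite mxE.
exact: vbasis_indep dimW sum0 i.
Qed.

(** A nonzero vector of [W] leads at a pivot, where its coordinate does not
    vanish: so [W] has a frame at its pivots, and its [i]-th vector, whose only
    nonzero coordinate at a pivot is the [i]-th one, leads there. *)
Lemma pivots_frame W b : \dim W = l -> pivots W b ->
  exists2 w, frame W b w & forall i, leading e (w i) (idx b i).
Proof.
move=> dimW Wb.
have lead_b v : v \in W -> v != 0 -> exists i, leading e v (idx b i).
  move=> vW /(leading_ex e_basis)[j vj].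
  have /Wb/mem_gridP[i ji] : is_pivot e W j by exists v.
  by exists i; rewrite -ji.
have [v vW v0|w fw] := @frame_ex W b dimW.
  apply/eqP/negPn/negP => /(lead_b v vW)[i []].
  by rewrite v0 eqxx.
exists w => // i; have [wW wb] := fw.
have wi_neq0 : w i != 0.
  apply/eqP => wi0; move: (wb i i); rewrite wi0 linear0 eqxx => /eqP.
  by rewrite eq_sym oner_eq0.
have [k lead_k] := lead_b _ (wW i) wi_neq0.
have [] := lead_k; rewrite wb.
by case: (eqVneq i k) lead_k => [-> //|_ _]; rewrite mulr0n eqxx.
Qed.

(** The positions in [b] are pivots, and there are as many of them as pivots. *)
Lemma frame_pivots W b w : \dim W = l -> frame W b w ->
  (forall i, leading e (w i) (idx b i)) -> pivots W b.
Proof.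
move=> dimW [wW _] lead_w; have [c Wc] := pivots_ex dimW.
suff -> : b = c by [].
apply: eq_grid => _ /mem_gridP[i ->]; apply/Wc.
by exists (w i).
Qed.

(** The vectors of [W] in [flag e k] are spanned by those vectors of a frame
    that sit at indices below [k]: this bounds the dimension. *)
Lemma schubert_frame W a c w : schubert e a W -> frame W c w -> grid_le c a.
Proof.
move=> [dimW Wa] fw; rewrite idx_le; apply/forallP => i.
rewrite -ltnS -card_idx_ltn; apply: leq_trans (Wa i) _.
set J := finset _.
rewrite cardE -(size_map w); apply: leq_trans (dim_span _).
apply: dimvS; apply/subvP => v /memv_capP[vW /mem_flag-/(_ e_basis) v0].
rewrite (frame_expand dimW fw vW); apply: memv_suml => j _.
have [lt_j | le_j] := ltnP (idx c j) (entry a i); last first.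
  by rewrite v0 // scale0r mem0v.
by apply/memvZ/memv_span/map_f; rewrite mem_enum inE.
Qed.

End Frames.

(** * Reduced echelon forms *)

Section Cells.
Variables (F : fieldType) (l m : nat) (V : vectType F) (e : m.-tuple V).
Hypothesis e_basis : basis_of fullv e.
Implicit Types (v : V) (W : {vspace V}) (a b c : grid l m).

(** The entries of a reduced row echelon matrix with pivots [b] that are not
    forced to be 0 or 1. *)
Definition free_pos b : {set 'I_l * 'I_m} :=
  [set p : 'I_l * 'I_m | (p.2 < idx b p.1)%N && (p.2 \notin val b)]%SET.

Definition echelon_row b (f : 'I_l * 'I_m -> F) (i : 'I_l) : V :=
  e`_(idx b i) + \sum_j f (i, j) *: e`_j.

Definition cell_point b (f : 'I_l * 'I_m -> F) : {vspace V} :=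
  <<mktuple (echelon_row b f)>>%VS.

Definition supported b (f : 'I_l * 'I_m -> F) : Prop :=
  forall p, p \notin free_pos b -> f p = 0.

Lemma coord_echelon_row b f i j :
  coord e j (echelon_row b f i) = (idx b i == j)%:R + f (i, j).
Proof.
rewrite linearD linear_sum /= (coordE e_basis); congr (_ + _).
rewrite (bigD1 j) //= linearZ /= (coordE e_basis) eqxx mulr1 big1 ?addr0 // => k.
by move=> /negbTE neq_kj; rewrite linearZ /= (coordE e_basis) neq_kj mulr0.
Qed.

Lemma cell_point_frame b f :
  supported b f -> frame e (cell_point b f) b (echelon_row b f).
Proof.
move=> supp_f; split=> [i|i k].
  by apply: memv_span; apply: map_f; rewrite mem_enum.
rewrite coord_echelon_row (inj_eq (@idx_inj _ _ b)) supp_f ?addr0 //.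
by rewrite inE /= idx_mem andbF.
Qed.

Lemma dim_cell_point b f : supported b f -> \dim (cell_point b f) = l.
Proof.
by move=> /cell_point_frame/frame_free; rewrite /free size_tuple => /eqP.
Qed.

Lemma cell_point_pivots b f : supported b f -> pivots e (cell_point b f) b.
Proof.
move=> supp_f; have fw := cell_point_frame supp_f.
apply: (frame_pivots e_basis (dim_cell_point supp_f) fw) => i; split.
  by have [_ ->] := fw; rewrite eqxx oner_eq0.
move=> j lt_ij; rewrite coord_echelon_row supp_f ?addr0.
  by rewrite -val_eqE ltn_eqF.
by rewrite inE /= ltnNge (ltnW lt_ij).
Qed.

(** The pivots are determined by the subspace, and the rows are the frame at the
    pivots, which is unique. *)
Lemma cell_point_inj b b' f f' : supported b f -> supported b' f' ->
  cell_point b f = cell_point b' f' -> b = b' /\ f =1 f'.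
Proof.
move=> supp_f supp_f' eqW.
have eq_b : b = b'.
  apply: pivots_inj (cell_point_pivots supp_f) _.
  by rewrite eqW; exact: cell_point_pivots.
split=> // -[i j]; case: _ / eq_b in supp_f' eqW *.
have := cell_point_frame supp_f'; rewrite -eqW.
move/(frame_uniq (dim_cell_point supp_f) (cell_point_frame supp_f))/(_ i).
by move/(congr1 (coord e j)); rewrite !coord_echelon_row => /addrI.
Qed.

(** The frame at the pivots is the reduced row echelon form of [W]. *)
Lemma cell_point_surj W b : \dim W = l -> pivots e W b ->
  exists2 f, supported b f & W = cell_point b f.
Proof.
move=> dimW Wb; have [w fw lead_w] := pivots_frame e_basis dimW Wb.
have [wW wb] := fw.
pose f (p : 'I_l * 'I_m) := if p \in free_pos b then coord e p.2 (w p.1) else 0.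
have supp_f : supported b f by move=> p /negbTE; rewrite /f => ->.
exists f => //; apply/esym/eqP; rewrite eqEdim dim_cell_point // dimW leqnn andbT.
apply/span_subvP => _ /mapP[i _ ->].
suff -> : echelon_row b f i = w i by [].
apply: (coord_inj e_basis) => j; rewrite coord_echelon_row /f inE /=.
have [/mem_gridP[k ->] | jNb] := boolP (j \in val b).
  by rewrite andbF addr0 wb (inj_eq (@idx_inj _ _ b)).
have /negbTE-> : idx b i != j by apply: contraNneq jNb => <-; exact: idx_mem.
rewrite add0r andbT; case: ltngtP => // [|/val_inj ji].
  by have [_ lead0] := lead_w i => /lead0.
by rewrite ji idx_mem in jNb.
Qed.

(** To the left of the [i]-th pivot (counted from 0) there are
    [entry b i - 1] positions, of which [i] are pivots. *)
Lemma card_free_pos b :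
  #|free_pos b| = (\sum_(i < l) entry b i - (l * l.+1) %/ 2)%N.
Proof.
have card_row i : (#|[set j | (i, j) \in free_pos b]%SET| + i.+1 = entry b i)%N.
  rewrite /entry -/(idx b i) addnS; congr _.+1.
  have low : #|[set j : 'I_m | (j < idx b i)%N]%SET| = idx b i.
    by rewrite card_ord_ltn // ltnW.
  have piv : #|[set j : 'I_m | (j < idx b i)%N && (j \in val b)]%SET| = i.
    rewrite -[RHS](card_ord_ltn (ltnW (ltn_ord i))) -(card_imset _ (@idx_inj _ _ b)).
    apply: eq_card => j; rewrite inE; apply/andP/imsetP.
      by move=> [lt_j /mem_gridP[k jk]]; exists k; rewrite // inE -(idx_ltn b) -jk.
    by move=> [k + ->]; rewrite inE -(idx_ltn b) idx_mem.
  rewrite -[RHS]low -[X in (_ + X)%N]piv addnC.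
  rewrite -[RHS](cardsID [set j in val b]%SET); congr (_ + _)%N.
    by apply: eq_card => j; rewrite !inE.
  by apply: eq_card => j; rewrite !inE andbC.
have tri : (l * l.+1 %/ 2 = \sum_(i < l) i.+1)%N.
  rewrite divn2 mulnC -bin2 -bin2_sum big_mkord big_ord_recl add0n.
  by apply: eq_bigr.
have -> : #|free_pos b| = (\sum_(i < l) #|[set j | (i, j) \in free_pos b]%SET|)%N.
  rewrite -sum1_card (eq_bigl (fun p => true && (p \in free_pos b))) //.
  transitivity (\sum_(p | predT p.1 && ((p.1, p.2) \in free_pos b)) 1)%N.
    by apply: eq_bigl => -[].
  rewrite -(pair_big_dep predT (fun i j => (i, j) \in free_pos b) (fun _ _ => 1%N)).
  by apply: eq_bigr => i _; rewrite sum1dep_card.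
rewrite tri -[X in (_ = X - _)%N](eq_bigr _ (fun i _ => card_row i)) big_split /=.
by rewrite addnK.
Qed.

End Cells.

(** * Unions of cells: points and linear span *)

Section CellUnions.
Variables (F : fieldType) (l m : nat) (V : vectType F) (e : m.-tuple V).
Hypothesis e_basis : basis_of fullv e.
Implicit Types (W : {vspace V}) (a b c d : grid l m) (G : {set grid l m}).

Definition cells G : set {vspace V} :=
  [set W | \dim W = l /\ exists2 b, b \in G & pivots e W b].

(** Echelon matrices over [F] are encoded by finite functions with values in
    ['I_q], through a bijection [g] between ['I_q] and [F]; [y0] is the code of 0,
    so that functions supported on the free positions stay so under [g]. *)
Lemma card_cells G (q : nat) : [set: F] #= `I_q ->
  cells G #= `I_(\sum_(b in G) q ^ #|free_pos b|)%N.
Proof.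
move=> /card_set_bijP[h [hI h_inj h_surj]].
have [g gK] : exists g : 'I_q -> F, forall i, h (g i) = i.
  suff /choice[g gK] : forall i : 'I_q, exists x, h x = i by exists g.
  by move=> i; have [|x _ <-] := h_surj i; [exact: ltn_ord | exists x].
have g_inj : injective g by move=> i j eq_g; apply: ord_inj; rewrite -gK eq_g gK.
have h_lt x : (h x < q)%N by exact: hI.
have g_surj x : g (Ordinal (h_lt x)) = x by apply: h_inj; rewrite ?inE // gK.
pose y0 := Ordinal (h_lt 0).
pose X := [set x : grid l m * {ffun 'I_l * 'I_m -> 'I_q} |
  (x.1 \in G) && (x.2 \in pffun_on y0 (free_pos x.1) predT)]%SET.
have -> : (\sum_(b in G) q ^ #|free_pos b| = #|X|)%N.
  rewrite -sum1dep_card.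
  rewrite -(pair_big_dep (mem G) (fun b f => f \in pffun_on y0 (free_pos b) predT)
    (fun _ _ => 1%N)).
  by apply: eq_bigr => b _; rewrite sum1_card card_pffun_on cardT size_enum_ord.
have suppX x : x \in X -> supported x.1 (g \o x.2).
  rewrite inE => /andP[_ /pffun_onP[/fintype.subsetP suppx _]] p /= p_free.
  suff -> : x.2 p = y0 by exact: g_surj.
  by apply: contraNeq p_free => xp; apply: suppx.
pose Phi (k : 'I_#|X|) :=
  cell_point e (enum_val k).1 (g \o (enum_val k).2).
have Phi_inj : injective Phi.
  move=> k k' /(cell_point_inj e_basis (suppX _ (enum_valP k)) (suppX _ (enum_valP k'))).
  move=> [eq1 eq2]; apply: enum_val_inj; move: eq1 eq2.
  case: (enum_val k) (enum_val k') => [b f] [b' f'] /= -> eq_f; congr (_, _).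
  by apply/ffunP => p; apply: g_inj; exact: eq_f.
have -> : cells G = Phi @` setT.
  apply/seteqP; split=> [W [dimW [b bG Wb]] | _ [k _ <-]].
    have [f supp_f ->] := cell_point_surj e_basis dimW Wb.
    pose f' := [ffun p => Ordinal (h_lt (f p))].
    have gf' : g \o f' = f by apply/funext => p /=; rewrite ffunE g_surj.
    have bf_X : (b, f') \in X.
      rewrite inE bG; apply/pffun_onP; split=> //; apply/fintype.subsetP => p.
      rewrite inE /= ffunE; apply: contraNT => p_free; apply/eqP/val_inj => /=.
      by rewrite (supp_f p p_free).
    by exists (enum_rank_in bf_X (b, f')); rewrite // /Phi enum_rankK_in //= gf'.
  have supp_k := suppX _ (enum_valP k); split; first exact: dim_cell_point.
  exists (enum_val k).1; last exact: cell_point_pivots.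
  by have := enum_valP k; rewrite inE => /andP[].
apply: card_eq_trans (inj_card_eq _) _; first by move=> ? ? _ _; exact: Phi_inj.
by rewrite card_eq_sym; exact: card_II.
Qed.

Definition basis_vector c : extpow F l m := [ffun d => (d == c)%:R].

Lemma scale_basis_vectorE (k : F) c d :
  (k *: basis_vector c) d = if d == c then k else 0.
Proof.
rewrite !ffunE; case: eqP => _; first exact: (mulr1 k).
exact: (mulr0 k).
Qed.

Definition coord_space G : {vspace extpow F l m} :=
  <<mktuple (fun i : 'I_#|G| => basis_vector (enum_val i))>>%VS.

Lemma sum_basis_vector G (u : 'I_#|G| -> F) d :
  (\sum_i u i *: (mktuple (fun i : 'I_#|G| => basis_vector (enum_val i)))`_i) d
  = \sum_(i | enum_val i == d) u i.
Proof.
rewrite sum_ffunE [RHS]big_mkcond; apply: eq_bigr => i _.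
by rewrite -tnth_nth tnth_mktuple scale_basis_vectorE eq_sym.
Qed.

Lemma dim_coord_space G : \dim (coord_space G) = #|G|.
Proof.
suff /eqP -> : free (mktuple (fun i : 'I_#|G| => basis_vector (enum_val i))).
  by rewrite size_tuple.
apply/freeP => u sum0 i; move/ffunP/(_ (enum_val i)): sum0.
by rewrite sum_basis_vector ffunE (big_pred1 i) // => j; rewrite (inj_eq enum_val_inj).
Qed.

Lemma mem_coord_space G (v : extpow F l m) :
  reflect (forall d, d \notin G -> v d = 0) (v \in coord_space G).
Proof.
apply: (iffP idP) => [/coord_span-> d dG | v0].
  rewrite sum_basis_vector big_pred0 // => i; apply: contraNF dG => /eqP <-.
  exact: enum_valP.
suff -> : v = \sum_(c in G) (v c : F) *: basis_vector c.
  apply: memv_suml => c cG; apply/memvZ/memv_span; apply/mapP.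
  by exists (enum_rank_in cG c); rewrite ?mem_enum // enum_rankK_in.
apply/ffunP => d; rewrite sum_ffunE.
have [dG | dNG] := boolP (d \in G); last first.
  rewrite v0 // big1 // => c cG; rewrite scale_basis_vectorE.
  by case: eqP => // dc; rewrite dc cG in dNG.
rewrite (bigD1 d) //= scale_basis_vectorE eqxx big1 ?addr0 // => c /andP[_ neq_cd].
by rewrite scale_basis_vectorE eq_sym (negbTE neq_cd).
Qed.

Lemma wedge_vbasis_neq0 W : \dim W = l ->
  wedge e (fun i : 'I_l => (vbasis W)`_i) != 0 :> extpow F l m.
Proof.
move=> dimW; have [b Wb] := pivots_ex e_basis dimW.
have [w fw _] := pivots_frame e_basis dimW Wb.
have : wedge e (fun i => (vbasis W)`_i) b != 0.
  by apply/wedge_vbasis_frame => //; exists w.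
by apply: contra_neq => ->; rewrite ffunE.
Qed.

Lemma dim_plucker W : \dim W = l -> \dim (plucker l e W) = 1%N.
Proof. by move=> dimW; rewrite dim_vline wedge_vbasis_neq0. Qed.

(** A frame at [d] of the span of the [e_(c_i)] exists only for [d = c]: if [c_i]
    is not an entry of [d], then [e_(c_i)] has no nonzero coordinate in [d]. *)
Lemma plucker_coordinate_subspace c :
  plucker l e (cell_point e c (fun=> 0)) = <[basis_vector c]>%VS.
Proof.
have supp0 : supported c (fun=> 0 : F) by [].
have dimW := dim_cell_point e_basis supp0; have fc := cell_point_frame e_basis supp0.
set W := cell_point _ _ _ in dimW fc *; set v := wedge e (fun i : 'I_l => (vbasis W)`_i).
have v0 d : d != c -> v d = 0.
  apply: contra_neq_eq => /(wedge_vbasis_frame _ _ dimW)[w fw].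
  apply/esym/eq_grid => _ /mem_gridP[i ->].
  have ei_neq0 : e`_(idx c i) != 0.
    by apply: (free_not0 (basis_free e_basis)); apply: mem_nth; rewrite size_tuple.
  apply: contraNT ei_neq0 => ciNd; apply/eqP.
  have eiW : e`_(idx c i) \in W.
    have [/(_ i) + _] := fc; rewrite /echelon_row big1 ?addr0 // => j _.
    by rewrite scale0r.
  rewrite (frame_expand dimW fw eiW) big1 // => k _; rewrite (coordE e_basis).
  have /negbTE-> : idx c i != idx d k by apply: contraNneq ciNd => ->; exact: idx_mem.
  by rewrite scale0r.
have v_eq : v = (v c : F) *: basis_vector c.
  apply/ffunP => d; rewrite scale_basis_vectorE.
  by have [->|/v0] := eqVneq d c.
have vc : v c != 0.
  apply: contra_neq (wedge_vbasis_neq0 dimW) => vc0.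
  by rewrite -/v v_eq vc0 scale0r.
apply/eqP; rewrite eqEdim dim_plucker // dim_vline /plucker -/v -memvE.
by rewrite {1}v_eq memvZ ?memv_line //=; case: (_ != 0).
Qed.

(** Down-closedness makes the Pluecker coordinates off [G] vanish on the cells
    of [G]: a frame of [W] at [c] forces [c] below the pivots of [W].  Each
    basis vector of the coordinate space is attained, at the centre of a cell. *)
Lemma linear_span_cells G : (forall b c, b \in G -> grid_le c b -> c \in G) ->
  linear_span l e (cells G) = coord_space G.
Proof.
move=> downG; have [sub_span min_span] := lspanP (affine_cone l e (cells G)).
apply/eqP; rewrite eqEsubv; apply/andP; split.
  apply: min_span => _ [W [dimW [b bG Wb]] /vlineP[k ->]].
  apply/mem_coord_space => d; apply: contraNeq; rewrite ffunE => kd_neq0.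
  have /(wedge_vbasis_frame _ _ dimW)[w fw] :
      wedge e (fun i : 'I_l => (vbasis W)`_i) d != 0.
    by apply: contra_neq kd_neq0 => ->; exact: mulr0.
  apply: downG bG _; apply: schubert_frame fw => //.
  by apply/(schubert_pivots e_basis _ dimW Wb); apply/forallP.
apply/span_subvP => _ /mapP[i _ ->]; apply: sub_span.
have supp0 : supported (enum_val i) (fun=> 0 : F) by [].
exists (cell_point e (enum_val i) (fun=> 0)); last first.
  by rewrite plucker_coordinate_subspace memv_line.
split; first exact: dim_cell_point.
by exists (enum_val i); [exact: enum_valP | exact: cell_point_pivots].
Qed.

(** The Pluecker coordinate of [W] at its own pivots does not vanish, so these
    pivots belong to [G] as soon as the coordinates off [G] vanish. *)
Lemma proj_span_cells G : (forall b c, b \in G -> grid_le c b -> c \in G) ->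
  grassmannian l V `&` plucker l e @^-1` proj_span l e (cells G) = cells G.
Proof.
move=> downG; apply/seteqP; split=> [W [dimW [_]] | W WG].
  rewrite linear_span_cells // -memvE => /mem_coord_space v0.
  have [b Wb] := pivots_ex e_basis dimW; split=> //; exists b => //.
  have [w fw _] := pivots_frame e_basis dimW Wb.
  have : wedge e (fun i : 'I_l => (vbasis W)`_i) b != 0.
    by apply/(wedge_vbasis_frame _ _ dimW); exists w.
  by apply: contraNT => /v0 ->.
have [dimW _] := WG; split=> //; split; first exact: dim_plucker.
have [sub_span _] := lspanP (affine_cone l e (cells G)).
by rewrite -memvE; apply: sub_span; exists W => //; exact: memv_line.
Qed.


End CellUnions.

(** * Unions and intersections of Schubert cycles *)

Lemma schubert_bigcup_cells (F : fieldType) (l m : nat) (V : vectType F)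
    (e : m.-tuple V) (s : nat) (alpha : 'I_s -> grid l m) : basis_of fullv e ->
  \bigcup_i schubert e (alpha i) = cells e (\bigcup_(i < s) below (alpha i))%SET.
Proof.
move=> e_basis; apply/seteqP; split=> [W [i _ Wi] | W [dimW [b + Wb]]].
  have [dimW _] := Wi; have [b Wb] := pivots_ex e_basis dimW.
  split=> //; exists b => //; apply/finset.bigcupP; exists i => //.
  by rewrite inE; apply/(schubert_pivots e_basis _ dimW Wb).
move=> /finset.bigcupP[i _]; rewrite inE => bi; exists i => //.
by apply/(schubert_pivots e_basis _ dimW Wb).
Qed.

Lemma below_bigcup_closed (l m s : nat) (alpha : 'I_s -> grid l m) b c :
  let GU := (\bigcup_(i < s) below (alpha i))%SET in
  b \in GU -> grid_le c b -> c \in GU.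
Proof.
move=> GU /finset.bigcupP[i _]; rewrite inE => /forallP bi /forallP cb.
apply/finset.bigcupP; exists i => //; rewrite inE; apply/forallP => j.
exact: leq_trans (cb j) (bi j).
Qed.

(** The entrywise minimum is attained, entry by entry, at one of the
    [alpha i]: so it is increasing, and the condition that it imposes on [W] at
    each index is the conjunction of those imposed by the [alpha i]. *)
Lemma grid_meet_ex (l m s : nat) (alpha : 'I_s -> grid l m) : (0 < s)%N ->
  exists gamma : grid l m,
    (forall i j, (entry gamma j <= entry (alpha i) j)%N) /\
    (forall j, exists i, entry gamma j = entry (alpha i) j).
Proof.
move=> s_gt0; pose i0 := Ordinal s_gt0.
pose low (j : 'I_l) := [arg min_(i < i0) idx (alpha i) j]%N.
have low_min j i : (idx (alpha (low j)) j <= idx (alpha i) j)%N.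
  by rewrite /low; case: arg_minnP => // i1 _ /(_ i); exact.
pose t := mktuple (fun j => idx (alpha (low j)) j).
have t_sorted : sorted ltn (map val t).
  apply/(sortedP 0%N) => k; rewrite size_map size_tuple => lt_k1.
  have lt_k := ltnW lt_k1.
  have nth_t (j : 'I_l) : nth 0%N (map val t) j = idx (alpha (low j)) j.
    rewrite (nth_map (tnth t j)) ?size_tuple //.
    by rewrite -tnth_nth tnth_mktuple.
  rewrite (nth_t (Ordinal lt_k)) (nth_t (Ordinal lt_k1)).
  by apply: leq_ltn_trans (low_min _ (low (Ordinal lt_k1))) _;
    rewrite idx_ltn.
have entry_t j : entry (exist _ t t_sorted : grid l m) j
    = entry (alpha (low j)) j by rewrite /entry /= tnth_mktuple.
exists (exist _ t t_sorted); split=> [i j | j].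
  by rewrite entry_t ltnS low_min.
by exists (low j).
Qed.

Lemma schubert_bigcap (F : fieldType) (l m : nat) (V : vectType F)
    (e : m.-tuple V) (s : nat) (alpha : 'I_s -> grid l m) (gamma : grid l m) :
  (0 < s)%N ->
  (forall i j, (entry gamma j <= entry (alpha i) j)%N) ->
  (forall j, exists i, entry gamma j = entry (alpha i) j) ->
  \bigcap_i schubert e (alpha i) = schubert e gamma.
Proof.
move=> s_gt0 gamma_le gamma_ex; apply/seteqP; split=> [W Wa | W [dimW Wg] i _].
  split=> [|j]; first by have [] := Wa (Ordinal s_gt0) I.
  by have [i ->] := gamma_ex j; have [_] := Wa i I; apply.
split=> // j; apply: leq_trans (Wg j) _; apply/dimvS/capvS => //.
rewrite /flag; apply: sub_span => v.
rewrite -(subnKC (gamma_le i j)) takeD mem_cat => ->.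
by [].
Qed.

Lemma below_bigcap (l m s : nat) (alpha : 'I_s -> grid l m) (gamma : grid l m) :
  (forall i j, (entry gamma j <= entry (alpha i) j)%N) ->
  (forall j, exists i, entry gamma j = entry (alpha i) j) ->
  below gamma = (\bigcap_(i < s) below (alpha i))%SET.
Proof.
move=> gamma_le gamma_ex; apply/setP => b; rewrite inE.
apply/forallP/finset.bigcapP => [bg i _ | ba j].
  by rewrite inE; apply/forallP => j; exact: leq_trans (bg j) (gamma_le i j).
by have [i ->] := gamma_ex j; have := ba i isT; rewrite inE => /forallP.
Qed.

Unset Implicit Arguments.

Theorem proposition2p4 (F : fieldType) (l m : nat) (l_ge1 : (1 <= l)%N)
    (l_lt_m : (l < m)%N) (V : vectType F) (e : m.-tuple V)
    (e_basis : basis_of fullv e) (s : nat) (s_ge1 : (1 <= s)%N)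
    (alpha : 'I_s -> grid l m) :
  let SU : set {vspace V} := \bigcup_i schubert e (alpha i) in
  let GU : {set grid l m} := (\bigcup_(i < s) below (alpha i))%SET in
  [/\ exists gamma : grid l m,
        \bigcap_i schubert e (alpha i) = schubert e gamma /\
        below gamma = (\bigcap_(i < s) below (alpha i))%SET,
      grassmannian l V `&` plucker l e @^-1` proj_span l e SU = SU,
      \dim (linear_span l e SU) = #|GU| &
      forall q : nat, [set: F] #= `I_q ->
        SU #= `I_(\sum_(x in GU) q ^ (\sum_(i < l) entry x i - (l * l.+1) %/ 2))%N].
Proof.
move=> SU GU; have downGU := @below_bigcup_closed l m s alpha.
rewrite /SU (schubert_bigcup_cells _ e_basis); split.
- have [gamma [gamma_le gamma_ex]] := grid_meet_ex alpha s_ge1.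
  by exists gamma; split; [exact: schubert_bigcap | exact: below_bigcap].
- exact: proj_span_cells.
- by rewrite linear_span_cells // dim_coord_space.
- move=> q /(card_cells e_basis GU).
  by under eq_bigr do rewrite card_free_pos.
Qed.
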